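(* Let $S$ be an ideal extension of $\mathbb{N}^k$ for some positive integer $k$. Then $\omega(S)<\infty$ if and only if $|\mathcal{H}(S)|<\infty$.
   Context: $\mathbb{N}$ is the set of non-negative integers and $\mathbb{N}^k$ is the additive monoid with componentwise addition. A subset $E\subseteq\mathbb{N}^k$ is an ideal if $E+\mathbb{N}^k\subseteq E$; a submonoid $S$ of $\mathbb{N}^k$ is an ideal extension of $\mathbb{N}^k$ if $S=E\cup\{\mathbf{0}\}$ for some ideal $E$ of $\mathbb{N}^k$. Put $S^*=S\setminus\{\mathbf{0}\}$; $\mathcal{H}(S)=\mathbb{N}^k\setminus S$ is the set of gaps of $S$; $\mathcal{A}(S)=S^*\setminus(S^*+S^* )$ is the set of atoms of $S$. Write $\mathbf{a}\le_S\mathbf{b}$ if $\mathbf{b}-\mathbf{a}\in S$. For $\mathbf{s}\in S$, the $\omega$-primality $\omega(\mathbf{s})$ is the least positive integer $N$ such that whenever $\mathbf{s}\le_S\mathbf{s}_1+\cdots+\mathbf{s}_n$ for some $\mathbf{s}_1,\dots,\mathbf{s}_n\in S$, then $\mathbf{s}\le_S\sum_{j\in J}\mathbf{s}_j$ for some $J\subseteq\{1,\dots,n\}$ with $|J|\le N$ ($\omega(\mathbf{s})=\infty$ if there is no such $N$). The $\omega$-primality of $S$ is $\omega(S)=\sup\{\omega(\mathbf{a}):\mathbf{a}\in\mathcal{A}(S)\}$.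
   Formalization: The ideal extension S is assumed to be different from {0} (the ideal E is nonempty); for S = {0}, arising from the empty ideal, there are no atoms, so ω(S) < ∞ while the set of gaps is infinite. *)

(* Defs.v *)
From HB Require Import structures.
From mathcomp Require Import all_boot all_order all_algebra.
From mathcomp Require Import boolp classical_sets cardinality.
From mathcomp Require Import reals constructive_ereal ereal.

Set Implicit Arguments.
Unset Strict Implicit.
Unset Printing Implicit Defensive.

Import Order.TTheory GRing.Theory Num.Theory.

Local Open Scope classical_set_scope.
Local Open Scope ring_scope.

Section IdealExtension.
Context {k : nat}.
Implicit Types (A B E S : set 'rV[nat]_k) (s a b : 'rV[nat]_k).

Definition sumset A B : set 'rV[nat]_k := [set a + b | a in A & b in B].

Definition is_submonoid S : Prop :=
  S 0 /\ forall a b, S a -> S b -> S (a + b).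

(* The empty set satisfies this definition, so that [set 0] is an ideal
   extension in the sense below. *)
Definition is_ideal E : Prop := sumset E setT `<=` E.

Definition ideal_extension S : Prop :=
  is_submonoid S /\ exists2 E, is_ideal E & S = E `|` [set 0].

Definition nonzero S : set 'rV[nat]_k := S `\ 0.

Definition gaps S : set 'rV[nat]_k := ~` S.

Definition atoms S : set 'rV[nat]_k :=
  nonzero S `\` sumset (nonzero S) (nonzero S).

(* There is no subtraction on nat vectors: b - a \in S means b = a + c with
   c in S. *)
Definition leS S a b : Prop := exists2 c, S c & b = a + c.

Definition omega_bound S s (N : nat) : Prop :=
  (0 < N)%N /\
  forall (n : nat) (t : 'I_n -> 'rV[nat]_k),
    (forall i, S (t i)) -> leS S s (\sum_i t i) ->
    exists2 J : {set 'I_n}, (#|J| <= N)%N & leS S s (\sum_(i in J) t i).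

Definition omega (R : realType) S s : \bar R :=
  if pselect (exists N, `[< omega_bound S s N >]) is left exN
  then (ex_minn exN)%:R%:E else +oo%E.

Definition omega_monoid (R : realType) S : \bar R :=
  ereal_sup [set omega R S a | a in atoms S].

End IdealExtension.

(* Main.v *)
Require Import Defs.
From HB Require Import structures.
From mathcomp Require Import all_boot all_order all_algebra.
From mathcomp Require Import boolp classical_sets cardinality.
From mathcomp Require Import reals constructive_ereal ereal.
From mathcomp Require Import zify.

(** Let [S^*] be the set of nonzero elements of [S]; it is an ideal. For every
    [s] in [S] one has [omega s <= |s| + 1], where [|s|] is the sum of the
    coordinates: if a sum of elements of [S] dominates [s] componentwise, so does
    a subsum of at most [|s|] terms, and one further nonzero term puts the
    difference in the ideal [S^*]. If [S] has finitely many gaps, its atoms are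
    bounded, since an atom with a large coordinate could be split along that
    axis; hence [omega S] is finite.

    Conversely, if there are infinitely many gaps, some axis meets [S] only in 0.
    Choose [s] in [S^*] whose part off this axis has minimal (hence positive) sum
    and whose coordinate on the axis is positive. All translates of [s] along the
    axis are atoms, and the number of copies of [s] needed to dominate them is
    unbounded. *)

Set Implicit Arguments.
Unset Strict Implicit.
Unset Printing Implicit Defensive.

Import Order.TTheory GRing.Theory Num.Theory.

Local Open Scope classical_set_scope.
Local Open Scope ring_scope.

(** Induction on [a]: a set reaching [a] either already reaches [a + 1], or gains a new index with
    positive [f]. If there is none, the set already carries the whole sum. *)
Lemma leq_sum_subset (I : finType) (f : I -> nat) (a : nat) :
  (a <= \sum_i f i)%N ->
  exists2 J : {set I}, (#|J| <= a)%N & (a <= \sum_(i in J) f i)%N.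
Proof.
elim: a => [_|a IHa lt_a]; first by exists finset.set0; rewrite ?cards0.
have [J leJ le_a] := IHa (ltnW lt_a).
have [lt_aJ|le_Ja] := ltnP a (\sum_(i in J) f i)%N; first by exists J => //; apply: leqW.
have [/existsP[j /andP[jJ fj]]|/existsPn noj] := boolP [exists j, (j \notin J) && (0 < f j)%N].
  exists (j |: J)%SET; first by rewrite cardsU1 jJ.
  by rewrite big_setU1 //=; lia.
move: lt_a; rewrite (bigID (mem J)) /= [X in (_ + X)%N]big1; first by lia.
by move=> i iJ; apply/eqP; have := noj i; rewrite iJ /= -eqn0Ngt.
Qed.

Section NatVectors.
Context {k : nat}.
Implicit Types (a b c x : 'rV[nat]_k) (i : 'I_k).

Definition axis_vec i (n : nat) : 'rV[nat]_k := \row_j (if j == i then n else 0%N).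

Lemma zerovE i : (0 : 'rV[nat]_k) 0%R i = 0%N.
Proof. by rewrite mxE. Qed.

Lemma addvE a b i : (a + b) 0%R i = (a 0%R i + b 0%R i)%N.
Proof. by rewrite mxE. Qed.

Lemma sumvE (I : finType) (P : pred I) (t : I -> 'rV[nat]_k) i :
  (\sum_(j | P j) t j) 0%R i = (\sum_(j | P j) t j 0%R i)%N.
Proof. exact: summxE. Qed.

Lemma vec_eq0 a : (forall i, a 0%R i = 0%N) -> a = 0.
Proof. by move=> a0; apply/rowP => i; rewrite a0 mxE. Qed.

Lemma vec_neq0 a : a <> 0 -> exists i, (0 < a 0%R i)%N.
Proof.
move=> a0; apply: contrapT => noi; apply: a0; apply: vec_eq0 => i.
by apply/eqP; rewrite -leqn0 leqNgt; apply/negP => ai; apply: noi; exists i.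
Qed.

Lemma vec_add_neq0 a b : a <> 0 -> a + b <> 0.
Proof. by move=> /vec_neq0[i ai] /rowP/(_ i); rewrite addvE zerovE; lia. Qed.

Lemma vec_leP a b : (forall i, (a 0%R i <= b 0%R i)%N) -> exists c, b = a + c.
Proof.
move=> le_ab; exists (\row_i (b 0%R i - a 0%R i)%N).
by apply/rowP => i; rewrite addvE mxE subnKC.
Qed.

Lemma vec_split_axis a i n : (n <= a 0%R i)%N -> exists c, a = axis_vec i n + c.
Proof. by move=> le_n; apply: vec_leP => j; rewrite mxE; case: eqP => // ->. Qed.

(** The scalar selection is made for each coordinate separately, and the union of the chosen index
    sets serves all coordinates at once. *)
Lemma vec_leq_sum_subset (I : finType) (t : I -> 'rV[nat]_k) a c :
  \sum_i t i = a + c ->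
  exists2 J : {set I}, (#|J| <= \sum_i a 0%R i)%N & exists d, \sum_(j in J) t j = a + d.
Proof.
move=> sum_t.
have le_a i : (a 0%R i <= \sum_j t j 0%R i)%N by rewrite -sumvE sum_t addvE leq_addr.
have /choice[J PJ] : forall i, exists J : {set I},
    (#|J| <= a 0%R i)%N /\ (a 0%R i <= \sum_(j in J) t j 0%R i)%N.
  by move=> i; have [J] := leq_sum_subset (le_a i); exists J.
exists (\bigcup_i J i)%SET.
  elim/big_ind2: _ => [|m A n B leA leB|i _]; first by rewrite cards0.
    by rewrite cardsU; lia.
  exact: (PJ i).1.
apply: vec_leP => i; rewrite sumvE; apply: leq_trans (PJ i).2 _.
rewrite [leqRHS](big_setID (J i)) /= (finset.setIidPr _) ?leq_addr //.
exact: finset.bigcup_sup.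
Qed.

Lemma finite_vec_bounded (A : set 'rV[nat]_k) :
  finite_set A <-> exists M, forall x, A x -> forall i, (x 0%R i < M)%N.
Proof.
split=> [/finite_seqP[X ->]|[M ltM]].
  exists (\max_(x <- X) \max_i x 0%R i).+1 => x /= xX i.
  rewrite ltnS; apply: (leq_trans (leq_bigmax (F := fun i => x 0%R i) i)).
  exact: (leq_bigmax_seq (F := fun y : 'rV[nat]_k => (\max_i y 0%R i)%N)).
(* Vectors with entries below [M] come from vectors over the finite type ['I_M]. *)
apply: (@sub_finite_set _ _ [set map_mx val y | y in [set: 'rV['I_M]_k]]).
  move=> x Ax; exists (\row_i Ordinal (ltM x Ax i)) => //.
  by apply/rowP => i; rewrite !mxE.
exact/finite_image/finite_finset.
Qed.

End NatVectors.

Section Omega.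
Context {k : nat}.
Implicit Types (S : set 'rV[nat]_k) (s a : 'rV[nat]_k).

Lemma nonzero_addr S a b : ideal_extension S -> nonzero S a -> nonzero S (a + b).
Proof.
move=> [_ [E idE ->]] [[Ea|//] a0]; split; last exact: vec_add_neq0.
by left; apply: idE; exists a => //; exists b.
Qed.

(** * Finite omega-primality as a uniform bound *)

Lemma omega_bound_leq S s m n : (m <= n)%N -> omega_bound S s m -> omega_bound S s n.
Proof.
move=> le_mn [m0 bd]; split=> [|l t St le_s]; first exact: leq_trans le_mn.
by have [J leJ ?] := bd l t St le_s; exists J => //; apply: leq_trans le_mn.
Qed.

Lemma omega_leP (R : realType) S s N : (0 < N)%N ->
  (omega R S s <= N%:R%:E)%E <-> omega_bound S s N.
Proof.
move=> N0; rewrite /omega; case: pselect => [exN|nexN].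
  case: ex_minnP => m /asboolP bm minm; rewrite lee_fin ler_nat; split.
    by move=> le_mN; apply: omega_bound_leq bm.
  by move=> bN; apply: minm; apply/asboolP.
split=> [|bN]; first by rewrite leye_eq.
by case: nexN; exists N; apply/asboolP.
Qed.

Lemma omega_monoid_ltyP (R : realType) S :
  (omega_monoid R S < +oo)%E <->
  exists N, forall a, atoms S a -> omega_bound S a N.
Proof.
split=> [sup_fin|[N bN]].
  have [r le_r] : exists r : R, (omega_monoid R S <= r%:E)%E.
    case: omega_monoid sup_fin => [r _|//|_]; first by exists r.
    (* The value [-oo] is the supremum over no atoms; any real bounds it. *)
    by exists 0; rewrite leNye.
  exists (Num.truncn r).+1 => a atom_a; apply/(omega_leP R) => //.
  apply: le_trans (_ : r%:E <= _)%E; last by rewrite lee_fin ltW ?truncnS_gt.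
  by apply: le_trans le_r; apply: ereal_sup_ubound; exists a.
apply: le_lt_trans (_ : N.+1%:R%:E < +oo)%E; last exact: ltry.
apply: ge_ereal_sup => _ [a atom_a <-]; apply/omega_leP => //.
by apply: omega_bound_leq (bN a atom_a).
Qed.

Lemma omega_bound_sum S s : ideal_extension S ->
  omega_bound S s (\sum_i s 0%R i).+1.
Proof.
move=> hS; split=> // n t St [c Sc sum_t].
have [J leJ [d sumJ]] := vec_leq_sum_subset sum_t.
have [[j jJ tj]|noj] := pselect (exists2 j, j \notin J & t j <> 0).
  exists (j |: J)%SET; first by rewrite cardsU1 jJ.
  exists (t j + d); last by rewrite big_setU1 //= sumJ addrCA.
  by have [] : nonzero S (t j + d) by apply: nonzero_addr.
(* All terms outside [J] vanish, so [J] carries the full sum and the original difference [c] still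
   works. *)
exists J; first exact: leqW.
exists c => //; rewrite -sum_t [RHS](bigID (mem J)) /= [X in _ + X]big1 ?addr0 //.
by move=> j jJ; apply: contrapT => tj; apply: noj; exists j.
Qed.

(** A coordinate of at least [2(M + 1)] splits so that both summands keep a coordinate above [M];
    each is then nonzero and not a gap. *)
Lemma atoms_bounded S M : ideal_extension S ->
  (forall x, gaps S x -> forall i, (x 0%R i < M)%N) ->
  forall a, atoms S a -> forall i, (a 0%R i < M.+1 + M.+1)%N.
Proof.
move=> hS gapM a [_ natom] i; rewrite ltnNge; apply/negP => le_a; apply: natom.
have big (x : 'rV[nat]_k) : (M < x 0%R i)%N -> nonzero S x.
  move=> ltMx; split; last by move=> x0; move: ltMx; rewrite x0 zerovE.
  by apply: contrapT => /gapM/(_ i); lia.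
have [c def_a] : exists c, a = axis_vec i M.+1 + c by apply: vec_split_axis; lia.
exists (axis_vec i M.+1); first by apply: big; rewrite mxE eqxx.
exists c => //; apply: big; move: le_a.
by rewrite def_a addvE mxE eqxx; lia.
Qed.

(** Everything above an axis element of [nonzero S] lies in [S], so these elements confine the gaps
    to a box. *)
Lemma finite_gaps_axis S : ideal_extension S ->
  (forall i, exists n, nonzero S (axis_vec i n)) -> finite_set (gaps S).
Proof.
move=> hS /choice[n Sn]; apply/finite_vec_bounded.
exists (\max_i n i).+1 => x gap_x i; rewrite ltnS leqNgt; apply/negP => lt_x.
apply: gap_x; have [c ->] : exists c, x = axis_vec i (n i) + c.
  by apply: vec_split_axis; apply: leq_trans (ltnW lt_x); apply: leq_bigmax.
by have [] := nonzero_addr c hS (Sn i).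
Qed.

(** * Atoms along an axis that misses [nonzero S] *)

Definition off_axis (i : 'I_k) a : nat := (\sum_(j | j != i) a 0%R j)%N.

Lemma off_axisD i a b : off_axis i (a + b) = (off_axis i a + off_axis i b)%N.
Proof. by rewrite /off_axis -big_split; apply: eq_bigr => j _; rewrite addvE. Qed.

Lemma off_axis_vec i n : off_axis i (axis_vec i n) = 0%N.
Proof. by apply: big1 => j /negbTE ji; rewrite mxE ji. Qed.

Lemma off_axis_eq0 i a : off_axis i a = 0%N -> a = axis_vec i (a 0%R i).
Proof.
move=> /eqP; rewrite sum_nat_eq0 => /forallP a0; apply/rowP => j; rewrite mxE.
by case: eqP => [->//|/eqP ji]; have := a0 j; rewrite ji => /eqP.
Qed.

(** In a splitting [b + c], the part of [c] off the axis is positive, so [b] would fall below the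
    minimum. *)
Lemma atom_min_off_axis S i a :
  (forall n, ~ nonzero S (axis_vec i n)) -> nonzero S a ->
  (forall b, nonzero S b -> (off_axis i a <= off_axis i b)%N) -> atoms S a.
Proof.
move=> no_axis Sa min_a; split=> // -[b Sb [c Sc def_a]].
have := min_a b Sb; rewrite -def_a off_axisD.
have : off_axis i c <> 0%N by move/off_axis_eq0=> def_c; apply: (no_axis (c 0%R i)); rewrite -def_c.
by lia.
Qed.

Lemma exists_min_off_axis S i : (exists a, nonzero S a) ->
  exists2 s, nonzero S s &
    forall b, nonzero S b -> (off_axis i s <= off_axis i b)%N.
Proof.
move=> [a Sa].
have exm : exists m, `[< exists2 s, nonzero S s & off_axis i s = m >].
  by exists (off_axis i a); apply/asboolP; exists a.
case: (ex_minnP exm) => m /asboolP[s Ss <-] min_m.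
by exists s => // b Sb; apply: min_m; apply/asboolP; exists b.
Qed.

Lemma omega_unbounded S i N : ideal_extension S -> (exists a, nonzero S a) ->
  (forall n, ~ nonzero S (axis_vec i n)) ->
  exists2 a, atoms S a & ~ omega_bound S a N.
Proof.
move=> hS neS no_axis; have [s0 Ss0 min_s0] := exists_min_off_axis i neS.
have [s [Ss si min_s]] : exists s, [/\ nonzero S s, (0 < s 0%R i)%N &
    forall b, nonzero S b -> (off_axis i s <= off_axis i b)%N].
  (* A unit step along the axis makes coordinate [i] positive and keeps the off-axis sum minimal. *)
  exists (s0 + axis_vec i 1); split; first exact: nonzero_addr.
    by rewrite addvE mxE eqxx addn1.
  by move=> b /min_s0; rewrite off_axisD off_axis_vec addn0.
(* The atom [s + axis_vec i n] has [i]-th coordinate [(N + 1) * s 0 i], out of reach for [N] copies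
   of [s]. *)
pose n := (N * s 0%R i)%N.
exists (s + axis_vec i n).
  apply: (@atom_min_off_axis S i) => //; first exact: nonzero_addr.
  by move=> b /min_s; rewrite off_axisD off_axis_vec addn0.
(* Of the [N + 2] copies, [N] dominate [axis_vec i n], one matches the summand [s], and the last
   puts the difference [s + d] in [S]. *)
move=> [_ /(_ N.+2 (fun=> s))[_||J leJ [c _ /rowP/(_ i)]]]; first by case: Ss.
  have [d def_d] : exists d, s *+ N = axis_vec i n + d.
    apply: vec_split_axis; rewrite -[N in s *+ N]card_ord -sumr_const sumvE.
    by rewrite sum_nat_const card_ord.
  exists (s + d); first by have [] := nonzero_addr d hS Ss.
  by rewrite sumr_const card_ord !mulrS def_d -[RHS]addrA [in RHS](addrCA _ s).
rewrite sumvE sum_nat_const !addvE mxE eqxx => def_J.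
have := leq_mul leJ (leqnn (s 0%R i)).
by rewrite def_J -/n; lia.
Qed.

End Omega.

(** [hS0] excludes the monoid [[set 0]]: it has no atoms, so its [omega_monoid] is [-oo], yet its
    gaps are infinite for [0 < k]. *)
Theorem proposition6p11 (R : realType) (k : nat) (S : set 'rV[nat]_k)
    (hk : (0 < k)%N) (hS : ideal_extension S) (hS0 : S <> [set 0]) :
  (omega_monoid R S < +oo)%E <-> finite_set (gaps S).
Proof.
split=> [/omega_monoid_ltyP[N bN]|/finite_vec_bounded[M gapM]].
  have neS : exists a, nonzero S a.
    apply: contrapT => noa; apply: hS0; apply/seteqP; split=> [a Sa|_ ->].
      by apply: contrapT => a0; apply: noa; exists a.
    by case: hS => -[].
  apply: finite_gaps_axis => // i; apply: contrapT => noi.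
  have [|a atom_a] := @omega_unbounded _ S i N hS neS; last by apply; apply: bN.
  by move=> n Sn; apply: noi; exists n.
apply/omega_monoid_ltyP; exists (\sum_(i < k) (M.+1 + M.+1)).+1 => a atom_a.
apply: omega_bound_leq (omega_bound_sum a hS).
by rewrite ltnS; apply: leq_sum => i _; apply/ltnW/(atoms_bounded hS gapM).
Qed.
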